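(* 1. An increasing function $F:[1,\infty)\to[0,\infty)$ is an SLA if and only if $$\int_1^{\infty}\frac{F(y)}{y^2}\,dy\le 1.$$ 2. Any SLA is dominated by an ASLA. 3. An SLA $F$ is an ASLA if and only if it is right-continuous and $$\int_1^{\infty}\frac{F(y)}{y^2}\,dy=1.$$
   Context: ''Increasing'' is meant in the non-strict sense. Trading game (discrete time, perfect information): $X_0:=1$, $\mathcal K_0:=1$; for $t=1,2,\dots$: Investor announces $p_t\in\mathbb R$, then Market announces $X_t\in[0,\infty)$, and $\mathcal K_t:=\mathcal K_{t-1}+p_t(X_t-X_{t-1})$. Put $X_t^*:=\max_{s\le t}X_s$. A strategy for Investor is a function $\Pi$ from the set of all finite sequences of Market's moves (including the empty one) to $\mathbb R$, prescribing $p_t=\Pi(X_1,\dots,X_{t-1})$. A strategy guarantees a property if the property holds for every infinite sequence $X_1,X_2,\dots\in[0,\infty)$ of Market's moves. An increasing function $F:[1,\infty)\to[0,\infty)$ is an SLA (simple lookback adjuster) if there exists a strategy for Investor that guarantees $\mathcal K_t\ge F(X_t^* )$ for all $t$. In this statement all SLAs are increasing functions by definition. An SLA $F$ dominates an SLA $G$ if $F(y)\ge G(y)$ for all $y\in[1,\infty)$; it strictly dominates $G$ if in addition $F(y)>G(y)$ for some $y\in[1,\infty)$. An SLA is an ASLA (admissible simple lookback adjuster) if it is not strictly dominated by any SLA. *)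

(* Defs.v *)
From mathcomp Require Import all_boot all_order all_algebra.
From mathcomp Require Import all_classical all_reals all_analysis.
Set Implicit Arguments.
Unset Strict Implicit.
Unset Printing Implicit Defensive.
Import Order.TTheory GRing.Theory Num.Theory.
Import numFieldNormedType.Exports.
Local Open Scope classical_set_scope.
Local Open Scope ring_scope.

(* The index of the price sequence X is time itself: X 0 is the initial price
   and Market's moves are X 1, X 2, ... *)
Definition price_path (R : realType) (X : nat -> R) : Prop :=
  X 0%N = 1 /\ forall t : nat, (0 < t)%N -> 0 <= X t.

(* A strategy maps the list [:: X 1; ...; X (t - 1)] of Market's past moves to
   the stake p_t. *)
Definition strategy (R : realType) : Type := seq R -> R.

Definition past_moves (R : realType) (X : nat -> R) (n : nat) : seq R :=
  [seq X s | s <- iota 1 n].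

Fixpoint capital (R : realType) (Pi : strategy R) (X : nat -> R) (t : nat) : R :=
  if t is n.+1
  then capital Pi X n + Pi (past_moves X n) * (X n.+1 - X n)
  else 1.

Definition running_max (R : realType) (X : nat -> R) (t : nat) : R :=
  \big[Num.max/X 0%N]_(s < t.+1) X s.

(* Functions on [1, +oo) are represented by total functions R -> R whose values
   below 1 are irrelevant: every notion below only looks at arguments >= 1. *)
Definition nneg_increasing (R : realType) (F : R -> R) : Prop :=
  (forall y : R, 1 <= y -> 0 <= F y) /\
  {in `[1, +oo[ &, {homo F : x y / x <= y}}.

Definition SLA (R : realType) (F : R -> R) : Prop :=
  nneg_increasing F /\
  exists Pi : strategy R, forall X : nat -> R, price_path X ->
    forall t : nat, F (running_max X t) <= capital Pi X t.

Definition dominates (R : realType) (F G : R -> R) : Prop :=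
  forall y : R, 1 <= y -> G y <= F y.

Definition strictly_dominates (R : realType) (F G : R -> R) : Prop :=
  dominates F G /\ exists2 y : R, 1 <= y & G y < F y.

Definition ASLA (R : realType) (F : R -> R) : Prop :=
  SLA F /\ forall G : R -> R, SLA G -> ~ strictly_dominates G F.

Definition right_continuous_from1 (R : realType) (F : R -> R) : Prop :=
  forall y : R, 1 <= y -> F x @[x --> y^'+] --> F y.

(* Main.v *)
Require Import Defs.
From mathcomp Require Import all_boot all_order all_algebra.
From mathcomp Require Import all_classical all_reals all_analysis.
From mathcomp Require Import measurable_realfun.
From mathcomp Require Import ring lra.
Set Implicit Arguments.
Unset Strict Implicit.
Unset Printing Implicit Defensive.
Import Order.TTheory GRing.Theory Num.Theory.
Import numFieldNormedType.Exports.
Local Open Scope classical_set_scope.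
Local Open Scope ring_scope.

(** If Market multiplies the price by r > 1 until a crash to 0, guaranteeing F
    forces a lower Riemann sum of F(y)/y^2 over the partition (r^k) to be at
    most 1, and r -> 1 bounds the integral.  Conversely, with
    U(x) = int_x^oo F(y)/y^2 dy, staking U(M) - F(M)/M at running maximum M is
    the hedge that guarantees F.  The Riemann sum argument tolerates replacing F
    by its right limit, so the right limit of an SLA is again an SLA; adding the
    constant 1 - int F(y)/y^2 dy to it gives a dominating ASLA, which coincides
    with F exactly when F is admissible. *)

(** * Running maximum and past moves *)

Lemma past_movesS (R : realType) (X : nat -> R) (n : nat) :
  past_moves X n.+1 = rcons (past_moves X n) (X n.+1).
Proof. by rewrite /past_moves -[in LHS](addn1 n) iotaD map_cat /= cats1 add1n. Qed.

Lemma running_max_le (R : realType) (X : nat -> R) (t : nat) (y : R) :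
  running_max X t <= y <-> forall s, (s <= t)%N -> X s <= y.
Proof.
split=> [Xy s st|Xy]; last first.
  by apply/bigmax_leP; split=> [|i _]; apply: Xy => //; rewrite -ltnS.
by have /bigmax_leP[_ /(_ (Ordinal (st : (s < t.+1)%N)) isT)] := Xy.
Qed.

Lemma running_max0 (R : realType) (X : nat -> R) : running_max X 0 = X 0%N.
Proof.
apply/le_anti/andP; split; first by apply/running_max_le => -[].
by have /running_max_le := lexx (running_max X 0); exact.
Qed.

Lemma running_maxS (R : realType) (X : nat -> R) (t : nat) :
  running_max X t.+1 = Num.max (running_max X t) (X t.+1).
Proof.
apply/le_anti/andP; split.
  apply/running_max_le => s; rewrite leq_eqVlt le_max => /predU1P[->|st].
    by rewrite lexx orbT.
  by apply/orP; left; have /running_max_le := lexx (running_max X t); exact.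
have /running_max_le Xle := lexx (running_max X t.+1).
rewrite ge_max Xle// andbT; apply/running_max_le => s st.
by apply: Xle; exact: leqW.
Qed.

Lemma past_moves_max (R : realType) (X : nat -> R) (t : nat) : X 0%N = 1 ->
  foldl Num.max 1 (past_moves X t) = running_max X t.
Proof.
move=> X0; elim: t => [|t IHt]; first by rewrite running_max0.
by rewrite past_movesS foldl_rcons IHt running_maxS.
Qed.

Lemma running_max_ge1 (R : realType) (X : nat -> R) (t : nat) : X 0%N = 1 ->
  1 <= running_max X t.
Proof.
by move=> <-; have /running_max_le := lexx (running_max X t); exact.
Qed.

(** Strategies cannot anticipate: this is what makes a path that will crash indistinguishable,
    before the crash, from one that keeps rising. *)
Lemma eq_capital (R : realType) (Pi : strategy R) (X Y : nat -> R) (t : nat) :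
  (forall s, (s <= t)%N -> X s = Y s) -> capital Pi X t = capital Pi Y t.
Proof.
elim: t => //= t IHt XY; rewrite IHt => [|s st]; last by apply: XY; exact: leqW.
rewrite !XY//; congr (_ + Pi _ * _); apply/eq_in_map => s.
by rewrite mem_iota add1n => /andP[_ st]; apply: XY; exact: ltnW.
Qed.

(** * The discrete game: Market's crash threats and Investor's hedge *)

Definition crash_path (R : realType) (r : R) (n t : nat) : R :=
  if (t <= n)%N then r ^+ t else 0.

Lemma crash_path_price_path (R : realType) (r : R) (n : nat) :
  1 < r -> price_path (crash_path r n).
Proof.
move=> r1; split=> [|t _]; first by rewrite /crash_path.
by rewrite /crash_path; case: ifP => // _; rewrite exprn_ge0// ltW// (lt_trans ltr01).
Qed.

Lemma crash_path_running_max (R : realType) (r : R) (n : nat) :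
  1 < r -> running_max (crash_path r n) n.+1 = r ^+ n.
Proof.
move=> r1; have r0 : 0 < r by exact: lt_trans r1.
apply/le_anti/andP; split.
  apply/running_max_le => s _; rewrite /crash_path; case: ifP => sn.
    by rewrite ler_eXn2l.
  by rewrite exprn_ge0// ltW.
have /running_max_le/(_ n) := lexx (running_max (crash_path r n) n.+1).
by rewrite {1}/crash_path leqnn; exact.
Qed.

(* Market multiplies the price by [r] until it possibly crashes to [0]: after
   [n] rises a crash leaves capital [C n - p n * r ^+ n >= F (r ^+ n)], which
   bounds the stake [p n] and hence the next capital [C n.+1]. *)
Lemma SLA_geometric_sum (R : realType) (F : R -> R) (r : R) (n : nat) :
  1 < r -> SLA F -> \sum_(k < n) F (r ^+ k) * (r ^- k - r ^- k.+1) <= 1.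
Proof.
move=> r1 [[F0 Fnd] [Pi HPi]].
have r0 : 0 < r by exact: lt_trans r1.
pose C k := capital Pi (fun t => r ^+ t) k.
pose p k := Pi (past_moves (fun t => r ^+ t) k).
have crashE k : capital Pi (crash_path r k) k = C k.
  by apply: eq_capital => s sk; rewrite /crash_path sk.
(* The crash comes at time [k.+1], when the maximum is still [r ^+ k] and the stake [p k] loses the
   whole price. *)
have crashF k : F (r ^+ k) <= C k - p k * r ^+ k.
  have /= := HPi _ (crash_path_price_path k r1) k.+1.
  rewrite crash_path_running_max// crashE.
  have -> : past_moves (crash_path r k) k = past_moves (fun t => r ^+ t) k.
    apply/eq_in_map => s; rewrite mem_iota add1n ltnS => /andP[_ sk].
    by rewrite /crash_path sk.
  by rewrite /crash_path ltnn leqnn sub0r mulrN.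
have C_ge0 k : 0 <= C k.
  rewrite -(crashE k); have /= := HPi _ (crash_path_price_path k r1) k.
  by apply: le_trans; apply/F0/running_max_ge1.
(* Capital discounted by the price pays for the sum: at each rise the left side drops by the slack
   in [crashF] times (r - 1) / r^(m+1). *)
have sumC m : C m / r ^+ m + \sum_(k < m) F (r ^+ k) * (r ^- k - r ^- k.+1) <= 1.
  elim: m => [|m IHm]; first by rewrite big_ord0 /C/= expr0 invr1 mulr1 addr0.
  apply: le_trans IHm; rewrite big_ord_recr/= addrCA [in leRHS]addrC lerD2l.
  have -> : C m.+1 = C m + p m * (r ^+ m.+1 - r ^+ m) by [].
  have rm0 : 0 < r ^+ m by rewrite exprn_gt0.
  rewrite exprS -subr_ge0.
  have -> : C m / r ^+ m - ((C m + p m * (r * r ^+ m - r ^+ m)) / (r * r ^+ m) +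
    F (r ^+ m) * (r ^- m - (r * r ^+ m)^-1)) =
    (C m - p m * r ^+ m - F (r ^+ m)) * ((r - 1) / (r * r ^+ m)).
    by field; rewrite !gt_eqF.
  apply: mulr_ge0; first by rewrite subr_ge0.
  by rewrite divr_ge0 ?mulr_ge0 ?subr_ge0// ltW.
apply: le_trans (sumC n); rewrite lerDr divr_ge0// exprn_ge0// ltW//.
Qed.

(* Investor stakes [U M - F M / M], where [M] is the current maximum; this
   keeps [K >= F M + X * (U M - F M / M)]. *)
Lemma SLA_of_potential (R : realType) (F U : R -> R) :
  nneg_increasing F -> U 1 <= 1 ->
  (forall x y, 1 <= x -> x <= y -> F x * (x^-1 - y^-1) <= U x - U y) ->
  (forall x, 1 <= x -> F x / x <= U x) ->
  SLA F.
Proof.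
move=> Finc U1 UB FU; split=> //.
pose q x := U x - F x / x.
have q0 x : 1 <= x -> 0 <= q x by move=> x1; rewrite subr_ge0 FU.
(* Folding from the initial price 1 recovers the running maximum from Market's moves alone. *)
exists (fun l => q (foldl Num.max 1 l)) => X [X0 Xge0] t.
have {}Xge0 s : 0 <= X s by case: s => [|s]; rewrite ?X0// Xge0.
have M1 s : 1 <= running_max X s by exact: running_max_ge1.
suff : F (running_max X t) + q (running_max X t) * X t <=
    capital (fun l => q (foldl Num.max 1 l)) X t.
  by apply: le_trans; rewrite lerDl mulr_ge0// q0.
elim: t => [|t IHt]; first by rewrite running_max0 X0 /q/= divr1 mulr1 addrC subrK.
rewrite [capital _ _ _]/= past_moves_max//.
set M := running_max X t in IHt *; set y := X t.+1.
(* The stake [q M] carries the invariant from the old price to the new price [y]; only a new maximum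
   then needs the hypothesis on [U]. *)
apply: (@le_trans _ _ (F M + q M * y)); last first.
  by rewrite mulrBr; move: IHt; set K := capital _ _ _; lra.
rewrite running_maxS -/M -/y; have [My|yM] := leP M y; last by [].
have M0 : 0 < M by apply: lt_le_trans (M1 t).
have y0 : 0 < y by apply: lt_le_trans My.
(* Since [F y + q y * y] equals [y * U y], the required inequality is the decrease condition on [U]
   multiplied by [y]. *)
have := UB M y (M1 t) My; rewrite -(ler_pM2r y0) /q -subr_ge0 => UBy.
rewrite -subr_ge0; apply: le_trans UBy _.
by rewrite le_eqVlt; apply/orP; left; apply/eqP; field; rewrite !gt_eqF.
Qed.

(** * Integrals against the weight 1/y^2 *)

Lemma continuous_div_sqr (R : realType) (c a : R) : 0 < a ->
  {within `[a, +oo[, continuous (fun y : R => c / y ^+ 2)}.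
Proof.
move=> a0; apply: continuous_in_subspaceT => x.
rewrite inE/= in_itv/= andbT => ax.
have xN0 : x != 0 by rewrite gt_eqF// (lt_le_trans a0).
apply: cvgM; first exact: cvg_cst.
by apply: cvgV; [rewrite expf_neq0|exact: exprn_continuous].
Qed.

Lemma integral_sqrV_tail (R : realType) (c a : R) : 0 <= c -> 0 < a ->
  (\int[lebesgue_measure]_(y in `[a, +oo[) (c / y ^+ 2)%:E = (c / a)%:E)%E.
Proof.
move=> c0 a0; pose P (y : R) : R := - c / y.
have dP (x : R) : a <= x -> is_derive x 1 P (c / x ^+ 2).
  move=> ax; have xN0 : x != 0 by rewrite gt_eqF// (lt_le_trans a0).
  have dV := is_deriveV xN0 (is_derive_id x (1 : R)).
  have := is_deriveM (is_derive_cst (- c) x (1 : R)) dV.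
  move=> dcV; apply: (is_derive_eq dcV).
  by rewrite scaler0 addr0 /GRing.scale/= mulr1 mulrNN.
rewrite (@ge0_continuous_FTC2y _ _ P _ 0).
- by rewrite sub0e -EFinN /P mulNr opprK.
- by move=> x ax; rewrite divr_ge0// sqr_ge0.
- exact: continuous_div_sqr.
- rewrite /P -[X in _ --> X](mulr0 (- c)); apply: cvgM; first exact: cvg_cst.
  apply/(gtr0_cvgV0 (f := @id R)); last exact: cvg_id.
  by near=> x; near: x; exact: nbhs_pinfty_gt.
- by move=> x ax; have [] := dP x (ltW ax).
- apply: cvg_at_right_filter; apply/differentiable_continuous/derivable1_diffP.
  by have [] := dP _ (lexx a).
- move=> x; rewrite in_itv/= andbT => /ltW /dP dPx.
  by rewrite derive1E; apply: derive_val.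
Unshelve. all: by end_near. Qed.

Lemma measurable_div_sqr (R : realType) (F : R -> R) : nneg_increasing F ->
  measurable_fun (`[1, +oo[ : set R) (fun y => (F y / y ^+ 2)%:E).
Proof.
move=> [_ Fnd]; apply/measurable_EFinP; apply: measurable_funM; last first.
  have := @continuous_div_sqr R 1 1 ltr01.
  move=> /subspace_continuous_measurable_fun => /(_ (measurable_itv _)).
  apply: eq_measurable_fun => y _. exact: div1r.
(* [F] is monotone only from 1 on; freezing it below 1 gives a function monotone on the whole
   line. *)
pose G (y : R) : R := F (Num.max 1 y).
apply: (eq_measurable_fun G).
  by move=> y; rewrite inE/= in_itv/= andbT => y1; rewrite /G max_r.
apply: nondecreasing_measurable => // x y xy.
have max1 (z : R) : Num.max 1 z \in `[1, +oo[.
  by rewrite in_itv/= andbT le_max lexx.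
by apply: Fnd => //; rewrite ge_max !le_max lexx xy orbT.
Qed.

Lemma measurable_div_sqr_sub (R : realType) (F : R -> R) (A : set R) :
  nneg_increasing F -> A `<=` `[1, +oo[ ->
  measurable_fun A (fun y => (F y / y ^+ 2)%:E).
Proof. by move=> Finc A1; apply: measurable_funS (measurable_div_sqr Finc). Qed.

Lemma div_sqr_ge0 (R : realType) (F : R -> R) (A : set R) :
  nneg_increasing F -> A `<=` `[1, +oo[ ->
  forall y, A y -> (0 <= (F y / y ^+ 2)%:E)%E.
Proof.
move=> [F0 _] A1 y /A1/=; rewrite in_itv/= andbT => y1.
by rewrite lee_fin divr_ge0 ?sqr_ge0 ?F0.
Qed.

Lemma nneg_increasing_cst (R : realType) (c : R) :
  0 <= c -> nneg_increasing (fun _ : R => c).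
Proof. by move=> c0; split. Qed.

Lemma sub_itv1y (R : realType) (a : R) (b : itv_bound R) : 1 <= a ->
  [set` Interval (BLeft a) b] `<=` `[1, +oo[.
Proof.
move=> a1 y /=; rewrite !itv_boundlr => /andP[ay _]; rewrite andbT.
by apply: le_trans ay; rewrite bnd_simp.
Qed.

(** The abstract right bound [z] lets the same statement cut half-open intervals and half-lines. *)
Lemma integral_split (R : realType) (F : R -> R) (a b : R) (z : itv_bound R) :
  nneg_increasing F -> 1 <= a -> a <= b -> (BLeft b <= z)%O ->
  (\int[lebesgue_measure]_(y in [set` Interval (BLeft a) z]) (F y / y ^+ 2)%:E =
   \int[lebesgue_measure]_(y in `[a, b[) (F y / y ^+ 2)%:E +
   \int[lebesgue_measure]_(y in [set` Interval (BLeft b) z]) (F y / y ^+ 2)%:E)%E.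
Proof.
move=> Finc a1 ab bz; rewrite (@itv_bndbnd_setU _ _ (BLeft a) (BLeft b) z)//.
have sub : `[a, b[ `|` [set` Interval (BLeft b) z] `<=` `[1, +oo[.
  by rewrite subUset; split; apply: sub_itv1y => //; exact: le_trans ab.
rewrite ge0_integral_setU//.
- exact: measurable_div_sqr_sub.
- exact: div_sqr_ge0.
- rewrite disj_set2E; apply/eqP/seteqP; split=> // y [/=].
  rewrite in_itv/= itv_boundlr bnd_simp => /andP[_ yb] /andP[by_ _].
  by rewrite ltNge by_ in yb.
Qed.

(** Obtained as the difference of two tails, both finite. *)
Lemma integral_sqrV (R : realType) (c a b : R) : 0 <= c -> 1 <= a -> a <= b ->
  (\int[lebesgue_measure]_(y in `[a, b[) (c / y ^+ 2)%:E =
   (c * (a^-1 - b^-1))%:E)%E.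
Proof.
move=> c0 a1 ab; have a0 : 0 < a by exact: lt_le_trans a1.
have b0 : 0 < b by exact: lt_le_trans ab.
have := @integral_split _ _ a b +oo%O (nneg_increasing_cst c0) a1 ab isT.
rewrite !integral_sqrV_tail// => /eqP; rewrite -sube_eq ?fin_num_adde_defl//.
by move=> /eqP <-; rewrite -EFinB mulrBr.
Qed.

Lemma le_integral_sqr (R : realType) (F G : R -> R) (A : set R) :
  measurable A -> nneg_increasing F -> nneg_increasing G -> A `<=` `[1, +oo[ ->
  (forall y, A y -> F y <= G y) ->
  (\int[lebesgue_measure]_(y in A) (F y / y ^+ 2)%:E <=
   \int[lebesgue_measure]_(y in A) (G y / y ^+ 2)%:E)%E.
Proof.
move=> mA Finc Ginc A1 FG; apply: ge0_le_integral => //.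
- exact: div_sqr_ge0.
- exact: measurable_div_sqr_sub.
- exact: measurable_div_sqr_sub.
- by move=> y Ay; rewrite lee_fin ler_wpM2r ?invr_ge0 ?sqr_ge0 ?FG.
Qed.

Lemma integral_sqr_addr (R : realType) (F : R -> R) (c : R) (A : set R) :
  measurable A -> nneg_increasing F -> 0 <= c -> A `<=` `[1, +oo[ ->
  (\int[lebesgue_measure]_(y in A) ((F y + c) / y ^+ 2)%:E =
   \int[lebesgue_measure]_(y in A) (F y / y ^+ 2)%:E +
   \int[lebesgue_measure]_(y in A) (c / y ^+ 2)%:E)%E.
Proof.
move=> mA Finc c0 A1; have cinc := nneg_increasing_cst c0.
rewrite -ge0_integralD//.
- by apply: eq_integral => y _; rewrite mulrDl EFinD.
- exact: div_sqr_ge0.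
- exact: measurable_div_sqr_sub.
- exact: div_sqr_ge0.
- exact: measurable_div_sqr_sub.
Qed.

(** * The integral criterion for SLAs *)

Lemma bigcup_itv_geometric (R : realType) (r : R) : 1 < r ->
  \bigcup_n `[1, r ^+ n[%classic = `[1, +oo[%classic :> set R.
Proof.
move=> r1; apply/seteqP; split=> [y [n _]/=|y /=]; rewrite !in_itv/= andbT.
  by case/andP.
move=> y1; have bernoulli n : 1 + (r - 1) * n%:R <= r ^+ n.
  elim: n => [|n IHn]; first by rewrite mulr0 addr0 expr0.
  rewrite exprS; apply: (@le_trans _ _ (r * (1 + (r - 1) * n%:R))).
    rewrite -natr1 -subr_ge0.
    have -> : r * (1 + (r - 1) * n%:R) - (1 + (r - 1) * (n%:R + 1)) =
      n%:R * (r - 1) ^+ 2 by ring.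
    by rewrite mulr_ge0// sqr_ge0.
  by rewrite ler_pM2l// (lt_trans ltr01).
have r10 : 0 < r - 1 by rewrite subr_gt0.
exists (Num.bound (y / (r - 1))) => //=; rewrite in_itv/= y1/=.
apply: lt_le_trans (bernoulli _).
have := archi_boundP (divr_ge0 (le_trans ler01 y1) (ltW r10)).
by rewrite ltr_pdivrMr// mulrC => /lt_trans; apply; rewrite ltrDr.
Qed.

(** On [r^n, r^(n+1)) the value of [G] is at most [F (r ^+ n.+2)]. Shifting the weights by two
    indices to match costs the factor r^2. Comparing [G] with [F] only at strictly larger points
    admits both [F] itself and its right limit as [G]. *)
Lemma integral_geometric_le (R : realType) (F G : R -> R) (r : R) (n : nat) :
  1 < r -> SLA F -> nneg_increasing G ->
  (forall x y, 1 <= x -> x < y -> G x <= F y) ->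
  (\int[lebesgue_measure]_(y in `[1%R, (r ^+ n)%R[) (G y / y ^+ 2)%:E <=
   (r ^+ 2)%:E)%E.
Proof.
move=> r1 SLAF Ginc GF; have r0 : 0 < r by exact: lt_trans r1.
have rX1 k : 1 <= r ^+ k by rewrite exprn_ege1// ltW.
have rX0 k : 0 < r ^+ k by rewrite exprn_gt0.
have F0 k : 0 <= F (r ^+ k) by have [[+ _] _] := SLAF; exact.
pose S m := \sum_(k < m) F (r ^+ k) * (r ^- k - r ^- k.+1).
have rXdiff k : r ^- k.+1 <= r ^- k.
  by rewrite lef_pV2 ?posrE// ler_eXn2l// leqnSn.
(* Because of the shift the terms of index 0 and 1 never occur, hence [S 2] is subtracted. *)
suff intS : (\int[lebesgue_measure]_(y in `[1%R, (r ^+ n)%R[) (G y / y ^+ 2)%:E <=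
    (r ^+ 2 * (S n.+2 - S 2))%:E)%E.
  apply: le_trans intS _; rewrite lee_fin ler_piMr ?sqr_ge0//.
  rewrite (le_trans _ (SLA_geometric_sum n.+2 r1 SLAF))// lerBlDr lerDl.
  by apply: sumr_ge0 => k _; rewrite mulr_ge0// subr_ge0.
elim: n => [|n IHn].
  by rewrite subrr mulr0 expr0 set_itvco0 integral_set0.
have rnS : r ^+ n <= r ^+ n.+1 by rewrite ler_eXn2l.
rewrite (@integral_split _ _ 1 (r ^+ n))// ?bnd_simp//.
have -> : r ^+ 2 * (S n.+3 - S 2) = r ^+ 2 * (S n.+2 - S 2) +
    F (r ^+ n.+2) * (r ^- n - r ^- n.+1).
  rewrite [S n.+3]/S big_ord_recr -/(S n.+2)/= !exprS; field.
  by rewrite !gt_eqF.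
rewrite EFinD leeD// -integral_sqrV//.
apply: le_integral_sqr => //.
- exact: nneg_increasing_cst.
- exact: sub_itv1y.
- move=> y /=; rewrite in_itv/= => /andP[yn yS]; apply: GF.
    exact: le_trans yn.
  by rewrite (lt_trans yS)// ltr_eXn2l.
Qed.

Lemma SLA_integral_le1 (R : realType) (F G : R -> R) :
  SLA F -> nneg_increasing G ->
  (forall x y, 1 <= x -> x < y -> G x <= F y) ->
  (\int[lebesgue_measure]_(y in `[1%R, +oo[) (G y / y ^+ 2)%:E <= 1)%E.
Proof.
move=> SLAF Ginc GF; apply/lee_addgt0Pr => e e0.
(* Chosen so that the loss factor r^2 is exactly 1 + e; monotone convergence along the intervals [1,
   r^n) then yields the full integral. *)
pose r := Num.sqrt (1 + e).
have r1 : 1 < r by rewrite -[ltLHS]sqrtr1 ltr_sqrt ?ltrDl// addr_gt0.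
have -> : (1 + e%:E = (r ^+ 2)%:E)%E by rewrite sqr_sqrtr// addr_ge0// ltW.
rewrite -(bigcup_itv_geometric r1).
have sub n : `[1, r ^+ n[%classic `<=` (`[1, +oo[ : set R) by exact: sub_itv1y.
have cvgI : ((\int[lebesgue_measure]_(y in `[1%R, (r ^+ n)%R[) (G y / y ^+ 2)%:E)
    @[n --> \oo] --> \int[lebesgue_measure]_(y in \bigcup_n `[1%R, (r ^+ n)%R[%classic)
      (G y / y ^+ 2)%:E)%E.
  apply: ge0_nondecreasing_set_cvg_integral => //.
  - move=> m n mn; apply/subsetPset => y /=; rewrite !in_itv/= => /andP[-> ym].
    by rewrite (lt_le_trans ym)// ler_eXn2l.
  - by move=> n; exact: measurable_div_sqr_sub.
  - by move=> n; exact: div_sqr_ge0.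
rewrite -(cvg_lim _ cvgI)//; apply: lime_le; first exact: cvgP cvgI.
by apply: nearW => n; exact: integral_geometric_le SLAF Ginc GF.
Qed.

(** The tail integral from [x] serves as potential. Both conditions on it follow by replacing [F] to
    the right of [x] by its lower bound [F x], on [x, y) and on the whole tail. *)
Lemma SLA_of_integral (R : realType) (F : R -> R) : nneg_increasing F ->
  (\int[lebesgue_measure]_(y in `[1%R, +oo[) (F y / y ^+ 2)%:E <= 1)%E -> SLA F.
Proof.
move=> Finc F1.
pose I x := (\int[lebesgue_measure]_(y in `[x, +oo[) (F y / y ^+ 2)%:E)%E.
have sub1 (x : R) : 1 <= x -> `[x, +oo[ `<=` `[1, +oo[%classic by exact: sub_itv1y.
have Ifin x : 1 <= x -> I x \is a fin_num.
  move=> x1; rewrite ge0_fin_numE; last first.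
    by apply: integral_ge0; apply: div_sqr_ge0 => //; exact: sub1.
  apply: (@le_lt_trans _ _ 1%E); last exact: ltry.
  apply: le_trans F1; apply: ge0_subset_integral => //.
  - exact: measurable_div_sqr.
  - exact: div_sqr_ge0.
  - exact: sub1.
apply: (@SLA_of_potential _ _ (fine \o I)) => //=.
- by rewrite -lee_fin fineK// Ifin.
- move=> x y x1 xy; have y1 : 1 <= y by exact: le_trans xy.
  have Fx0 : 0 <= F x by apply: Finc.1.
  rewrite -lee_fin EFinB !fineK ?Ifin// leeBrDr ?Ifin//.
  rewrite /I (@integral_split _ _ x y)// leeD2r// -integral_sqrV//.
  apply: le_integral_sqr => //.
  + exact: nneg_increasing_cst.
  + exact: sub_itv1y.
  + move=> z /=; rewrite in_itv/= => /andP[xz _].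
    by apply: Finc.2; rewrite ?in_itv/= ?andbT// (le_trans x1).
- move=> x x1; have Fx0 : 0 <= F x by apply: Finc.1.
  rewrite -lee_fin fineK ?Ifin// -integral_sqrV_tail ?(lt_le_trans ltr01)//.
  apply: le_integral_sqr => //.
  + exact: nneg_increasing_cst.
  + exact: sub1.
  + move=> z /=; rewrite in_itv/= andbT => xz.
    by apply: Finc.2; rewrite ?in_itv/= ?andbT// (le_trans x1).
Qed.

Lemma SLA_integral (R : realType) (F : R -> R) : SLA F ->
  (\int[lebesgue_measure]_(y in `[1%R, +oo[) (F y / y ^+ 2)%:E <= 1)%E.
Proof.
move=> SLAF; have [[F0 Fnd] _] := SLAF; apply: (SLA_integral_le1 SLAF) => //.
move=> x y x1 xy; apply: Fnd; rewrite ?in_itv/= ?andbT ?(ltW xy)//.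
by rewrite (le_trans x1)// ltW.
Qed.

(** * Right limits of SLAs *)

(** The infimum form gives the order bounds directly; [cvg_right_limit] identifies it with the limit
    from the right. *)
Definition right_limit (R : realType) (F : R -> R) (x : R) : R :=
  inf [set F y | y in `]x, +oo[].

Lemma right_limit_le (R : realType) (F : R -> R) (x y : R) :
  nneg_increasing F -> 1 <= x -> x < y -> right_limit F x <= F y.
Proof.
move=> [F0 _] x1 xy; apply: ge_inf; last by exists y => //=; rewrite in_itv/= xy.
exists 0 => _ [z /= + <-]; rewrite in_itv/= andbT => xz.
by apply: F0; rewrite (le_trans x1)// ltW.
Qed.

Lemma le_right_limit (R : realType) (F : R -> R) (x c : R) :
  (forall y, x < y -> c <= F y) -> c <= right_limit F x.
Proof.
move=> cF; apply: lb_le_inf.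
  by exists (F (x + 1)), (x + 1) => //=; rewrite in_itv/= ltrDl ltr01.
by move=> _ [y /= + <-]; rewrite in_itv/= andbT; exact: cF.
Qed.

Lemma right_limit_ge (R : realType) (F : R -> R) (x : R) :
  nneg_increasing F -> 1 <= x -> F x <= right_limit F x.
Proof.
move=> [_ Fnd] x1; apply: le_right_limit => y xy.
by apply: Fnd; rewrite ?in_itv/= ?andbT ?(ltW xy)// (le_trans x1)// ltW.
Qed.

Lemma right_limit_nneg_increasing (R : realType) (F : R -> R) :
  nneg_increasing F -> nneg_increasing (right_limit F).
Proof.
move=> Finc; split=> [x x1|x y].
  by apply: le_trans (right_limit_ge Finc x1); apply: Finc.1.
rewrite !in_itv/= !andbT => x1 y1 xy; apply: le_right_limit => z yz.
by apply: right_limit_le => //; exact: le_lt_trans yz.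
Qed.

Lemma cvg_right_limit (R : realType) (F : R -> R) (x : R) :
  nneg_increasing F -> 1 <= x -> F y @[y --> x^'+] --> right_limit F x.
Proof.
move=> [F0 Fnd] x1; apply: nondecreasing_at_right_cvgr => //.
- move=> y z; rewrite !in_itv/= !andbT => xy xz.
  by apply: Fnd; rewrite in_itv/= andbT (le_trans x1)// ltW.
- exists 0 => _ [z /= + <-]; rewrite in_itv/= andbT => xz.
  by apply: F0; rewrite (le_trans x1)// ltW.
Qed.

Lemma right_limit_right_continuous (R : realType) (F : R -> R) :
  nneg_increasing F -> right_continuous_from1 (right_limit F).
Proof.
move=> Finc x x1; have Gind := right_limit_nneg_increasing Finc.
(* Taking right limits is idempotent: the midpoint of [x] and [y] separates the two successive
   limits. *)
suff -> : right_limit F x = right_limit (right_limit F) x.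
  exact: cvg_right_limit.
apply/le_anti; rewrite right_limit_ge//=.
apply: le_right_limit => y xy.
have [xm my] := midf_lt xy.
apply: (@le_trans _ _ (right_limit F ((x + y) / 2))).
  exact: right_limit_le.
by apply: right_limit_le => //; rewrite (le_trans x1)// ltW.
Qed.

(** The strategy for [F] is not adapted; it bounds the integral of the right limit, and the
    criterion then supplies a new strategy. *)
Lemma SLA_right_limit (R : realType) (F : R -> R) : SLA F -> SLA (right_limit F).
Proof.
move=> SLAF; have [Finc _] := SLAF.
have Ginc := right_limit_nneg_increasing Finc.
apply: SLA_of_integral => //; apply: (SLA_integral_le1 SLAF) => // x y.
exact: right_limit_le.
Qed.

(** * Topping up and admissibility *)

(* Adding the missing mass as a constant exhausts the budget, since
   [\int_1^oo c / y ^+ 2 = c]. *)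
Definition top_up (R : realType) (F : R -> R) (x : R) : R :=
  F x + (1 - fine (\int[lebesgue_measure]_(y in `[1%R, +oo[) (F y / y ^+ 2)%:E)%E).

Lemma SLA_integral_fin_num (R : realType) (F : R -> R) : SLA F ->
  (\int[lebesgue_measure]_(y in `[1%R, +oo[) (F y / y ^+ 2)%:E)%E \is a fin_num.
Proof.
move=> SLAF; rewrite ge0_fin_numE; last first.
  by apply: integral_ge0; apply: div_sqr_ge0 => //; exact: SLAF.1.
exact: le_lt_trans (SLA_integral SLAF) (ltry _).
Qed.

Lemma top_up_cst_ge0 (R : realType) (F : R -> R) : SLA F ->
  0 <= 1 - fine (\int[lebesgue_measure]_(y in `[1%R, +oo[) (F y / y ^+ 2)%:E)%E.
Proof.
by move=> SLAF; rewrite subr_ge0 -lee_fin fineK ?SLA_integral_fin_num ?SLA_integral.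
Qed.

Lemma integral_top_up (R : realType) (F : R -> R) : SLA F ->
  (\int[lebesgue_measure]_(y in `[1%R, +oo[) (top_up F y / y ^+ 2)%:E = 1)%E.
Proof.
move=> SLAF; rewrite integral_sqr_addr ?top_up_cst_ge0//; last exact: SLAF.1.
rewrite integral_sqrV_tail ?top_up_cst_ge0// divr1.
by rewrite EFinB fineK ?SLA_integral_fin_num// addeC subeK ?SLA_integral_fin_num.
Qed.

Lemma SLA_top_up (R : realType) (F : R -> R) : SLA F -> SLA (top_up F).
Proof.
move=> SLAF; apply: SLA_of_integral; last by rewrite integral_top_up.
have [[F0 Fnd] _] := SLAF; split=> [y y1|x y x1 y1 xy].
  by rewrite addr_ge0 ?F0 ?top_up_cst_ge0.
by rewrite lerD2r Fnd.
Qed.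

(** Right continuity of [F] and monotonicity of [G] spread a gain at one point [y] over an interval
    [y, z), which pushes the integral of [G] above 1. *)
Lemma ASLA_of_integral (R : realType) (F : R -> R) : SLA F ->
  right_continuous_from1 F ->
  (\int[lebesgue_measure]_(y in `[1%R, +oo[) (F y / y ^+ 2)%:E = 1)%E ->
  ASLA F.
Proof.
move=> SLAF Frc F1; split=> // G SLAG [GF [y y1 FG]].
have [Finc _] := SLAF; have [Ginc _] := SLAG.
(* Half of the gap is given up to the growth of [F] on [y, z); the other half remains as a uniform
   gain there. *)
pose e := (G y - F y) / 2.
have e0 : 0 < e by rewrite divr_gt0// subr_gt0.
have : \forall x \near y^'+, y < x /\ F x < F y + e.
  near=> x; split; near: x; first exact: nbhs_right_gt.
  by apply: (cvgr_lt _ (Frc y y1)); rewrite ltrDl.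
move=> /filter_ex[z [yz Fz]].
have y0 : 0 < y by exact: lt_le_trans y1.
have e'0 : 0 < e * (y^-1 - z^-1).
  by rewrite mulr_gt0// subr_gt0 ltf_pV2 ?posrE// (lt_trans y0).
have Feinc : nneg_increasing (fun x => F x + e).
  have [F0 Fnd] := Finc; split=> [x x1|x x' x1 x'1 xx'].
    by rewrite addr_ge0 ?F0// ltW.
  by rewrite lerD2r Fnd.
have FeG x : y <= x -> x < z -> F x + e <= G x.
  move=> yx xz; have x1 : 1 <= x by exact: le_trans yx.
  have Fxz : F x <= F z.
    by apply: Finc.2; rewrite ?in_itv/= ?andbT ?(ltW xz)// (le_trans x1)// ltW.
  have Gyx : G y <= G x by apply: Ginc.2; rewrite ?in_itv/= ?andbT.
  by move: Fz; rewrite /e; lra.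
have z1 : 1 <= z by rewrite (le_trans y1)// ltW.
have /le_trans/(_ (SLA_integral SLAG)) :
  (\int[lebesgue_measure]_(x in `[1%R, +oo[) (F x / x ^+ 2)%:E +
   (e * (y^-1 - z^-1))%:E <=
   \int[lebesgue_measure]_(x in `[1%R, +oo[) (G x / x ^+ 2)%:E)%E.
  (* Only the middle piece gains; on the outer two plain domination suffices. *)
  have splitz H : nneg_increasing H ->
    (\int[lebesgue_measure]_(x in `[1%R, +oo[) (H x / x ^+ 2)%:E =
     \int[lebesgue_measure]_(x in `[1%R, y[) (H x / x ^+ 2)%:E +
     (\int[lebesgue_measure]_(x in `[y, z[) (H x / x ^+ 2)%:E +
      \int[lebesgue_measure]_(x in `[z, +oo[) (H x / x ^+ 2)%:E))%E.
    move=> Hinc; rewrite (@integral_split _ _ 1 y)//.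
    by rewrite (@integral_split _ _ y z)// ltW.
  rewrite !splitz// -addeA; apply: leeD.
    apply: le_integral_sqr => //; first exact: sub_itv1y.
    by move=> x /=; rewrite in_itv/= => /andP[x1 _]; exact: GF.
  rewrite addeAC; apply: leeD.
    rewrite -integral_sqrV// ?(ltW e0) ?(ltW yz)//.
    rewrite -integral_sqr_addr// ?(ltW e0)//; last exact: sub_itv1y.
    apply: le_integral_sqr => //; first exact: sub_itv1y.
    by move=> x /=; rewrite in_itv/= => /andP[]; exact: FeG.
  apply: le_integral_sqr => //; first exact: sub_itv1y.
  move=> x /=; rewrite in_itv/= andbT => zx; apply: GF.
  exact: le_trans zx.
by rewrite F1 -EFinD lee_fin gerDl leNgt e'0.
Unshelve. all: by end_near. Qed.

Lemma ASLA_top_up_right_limit (R : realType) (F : R -> R) : SLA F ->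
  ASLA (top_up (right_limit F)).
Proof.
move=> SLAF; have SLAG := SLA_right_limit SLAF.
apply: ASLA_of_integral; [exact: SLA_top_up| |exact: integral_top_up].
move=> x x1; apply: cvgD; last exact: cvg_cst.
exact: (right_limit_right_continuous SLAF.1).
Qed.

Lemma dominates_top_up_right_limit (R : realType) (F : R -> R) : SLA F ->
  dominates (top_up (right_limit F)) F.
Proof.
move=> SLAF y y1; apply: (le_trans (right_limit_ge SLAF.1 y1)).
by rewrite lerDl top_up_cst_ge0//; exact: SLA_right_limit.
Qed.

Theorem proposition2p1 (R : realType) :
  (forall F : R -> R, nneg_increasing F ->
     (SLA F <->
      (\int[lebesgue_measure]_(y in `[1%R, +oo[) (F y / y ^+ 2)%:E <= 1)%E)) /\
  (forall F : R -> R, SLA F ->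
     exists G : R -> R, ASLA G /\ dominates G F) /\
  (forall F : R -> R, SLA F ->
     (ASLA F <->
      right_continuous_from1 F /\
      (\int[lebesgue_measure]_(y in `[1%R, +oo[) (F y / y ^+ 2)%:E = 1)%E)).
Proof.
split=> [F Finc|]; first by split; [exact: SLA_integral|exact: SLA_of_integral].
split=> F SLAF.
  exists (top_up (right_limit F)); split; first exact: ASLA_top_up_right_limit.
  exact: dominates_top_up_right_limit.
split=> [[_ maxF]|[Frc F1]]; last exact: ASLA_of_integral.
(* The topped-up right limit is an SLA dominating [F], so maximality of [F] forbids any strict
   gain. *)
have eqF y : 1 <= y -> top_up (right_limit F) y = F y.
  have [SLAG _] := ASLA_top_up_right_limit SLAF.
  have GF := dominates_top_up_right_limit SLAF.
  move=> y1; apply/le_anti; rewrite GF// andbT leNgt; apply/negP => FG.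
  by apply: (maxF _ SLAG); split=> //; exists y.
have SLAR := SLA_right_limit SLAF.
split=> [y y1|]; last first.
  rewrite -(integral_top_up SLAR); apply: eq_integral => y.
  by rewrite inE/= in_itv/= andbT => /eqF ->.
(* The right limit lies between [F] and its own top-up, which have just been shown equal. *)
suff -> : F y = right_limit F y by apply: cvg_right_limit => //; exact: SLAF.1.
apply/le_anti; rewrite (right_limit_ge SLAF.1 y1)/= -(eqF y y1).
by rewrite lerDl top_up_cst_ge0.
Qed.
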